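(* Let $n,k$ be integers with $k\ge1$, $n>2k$. Let $m$ be a positive integer with $m<k$, and let $r\in\{0,\dots,m-1\}$ with $r\equiv k\pmod m$, and suppose $m>2r>0$. Then (a) if $m\mid n$, $\beta(P(n,k))\le \frac{n}{m}\,\beta(P(m,r))$; (b) if $m\nmid n$, $\beta(P(n,k))\le \left\lfloor\frac{n}{m}\right\rfloor\beta(P(m,r))+2k$.
   Context: For integers $N>2K\ge 2$, $P(N,K)$ is the generalized Petersen graph with vertices $u_1,\dots,u_N,v_1,\dots,v_N$ and edges $u_iu_{i+1}$, $u_iv_i$, $v_iv_{i+K}$ (subscripts modulo $N$). $\beta(G)$ denotes the size of a minimum vertex cover of $G$. *)

(* Defs.v *)
From mathcomp Require Import all_boot.

Set Implicit Arguments.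
Unset Strict Implicit.
Unset Printing Implicit Defensive.

(* A finite graph is given by its vertex type T and adjacency relation e. *)

Definition vertex_cover (T : finType) (e : rel T) (S : {set T}) : bool :=
  [forall x, forall y, e x y ==> (x \in S) || (y \in S)].

(* The default [set: T] of the arg min is itself a vertex cover. *)
Definition vertex_cover_number (T : finType) (e : rel T) : nat :=
  #|[arg min_(S < [set: T] | vertex_cover e S) #|S|]|.

(* Subscripts are 0, ..., N-1 instead of 1, ..., N; they are read modulo N.
   inl i is the outer vertex u_i and inr i is the inner vertex v_i. *)
Definition gpetersen_arc (N K : nat) : rel ('I_N + 'I_N) := fun x y =>
  match x, y with
  | inl i, inl j => j == i + 1 %[mod N]
  | inl i, inr j => j == i
  | inr i, inr j => j == i + K %[mod N]
  | inr _, inl _ => false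
  end.

(* Meaningful for 2 <= 2 * K < N, in which case it is a simple graph, see
   gpetersen_irr. *)
Definition gpetersen (N K : nat) : rel ('I_N + 'I_N) := fun x y =>
  gpetersen_arc K x y || gpetersen_arc K y x.

Lemma vertex_coverT (T : finType) (e : rel T) : vertex_cover e [set: T].
Proof. by apply/forallP=> x; apply/forallP=> y; rewrite in_setT implybT. Qed.

Lemma vertex_cover_number_min (T : finType) (e : rel T) (S : {set T}) :
  vertex_cover e S -> vertex_cover_number e <= #|S|.
Proof.
move=> covS; rewrite /vertex_cover_number.
by case: arg_minnP => [|S0 _ minS0]; [apply: vertex_coverT | apply: minS0].
Qed.

Lemma vertex_cover_number_attained (T : finType) (e : rel T) :
  exists2 S : {set T}, vertex_cover e S & #|S| = vertex_cover_number e.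
Proof.
rewrite /vertex_cover_number.
by case: arg_minnP => [|S covS _]; [apply: vertex_coverT | exists S].
Qed.

Lemma gpetersen_sym N K : symmetric (@gpetersen N K).
Proof. by move=> x y; rewrite /gpetersen orbC. Qed.

Lemma gpetersen_irr N K : 0 < K -> 2 * K < N -> irreflexive (@gpetersen N K).
Proof.
move=> K_gt0 K2N.
have KN : K < N by apply: leq_ltn_trans K2N; rewrite leq_pmull.
have N1 : 1 < N by apply: leq_ltn_trans KN.
have neq d (i : 'I_N) : 0 < d < N -> (i == i + d %[mod N]) = false.
  case/andP=> d_gt0 dN; rewrite -[X in X %% _ == _]addn0 eqn_modDl mod0n.
  by rewrite modn_small // eq_sym eqn0Ngt d_gt0.
by case=> i; rewrite /gpetersen /= orbb neq // K_gt0.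
Qed.

(* Main.v *)
Require Import Defs.
From mathcomp Require Import all_boot.

(** Reducing subscripts modulo [m] sends arcs of P(n,k) to arcs of P(m,r), apart
    from those that wrap around [n] when [m] does not divide [n]. Hence the
    preimage of a minimum cover of P(m,r) covers P(n,k) when [m %| n]. Otherwise
    every arc that wraps around starts at one of the last [k] subscripts: adding
    those [2 * k] vertices repairs the cover, and since [n %% m < k] the subscripts
    outside the last [k] all lie in the first [n %/ m] blocks of length [m]. *)

Definition gpetersen_index {N : nat} (x : 'I_N + 'I_N) : nat :=
  match x with inl i | inr i => i end.

Definition gpetersen_proj {n m : nat} (hm : 0 < m) (x : 'I_n + 'I_n) :
    'I_m + 'I_m :=
  match x with
  | inl i => inl (Ordinal (ltn_pmod i hm))
  | inr i => inr (Ordinal (ltn_pmod i hm))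
  end.

Lemma vertex_cover_gpetersen {N K : nat} (S : {set 'I_N + 'I_N}) :
  (forall x y, gpetersen_arc K x y -> (x \in S) || (y \in S)) ->
  vertex_cover (@gpetersen N K) S.
Proof.
move=> covS; apply/forallP=> x; apply/forallP=> y; apply/implyP.
by case/orP=> /covS //; rewrite orbC.
Qed.

Lemma modn_eq_dvd {n m a b : nat} :
  m %| n -> a = b %[mod n] -> a = b %[mod m].
Proof. by move=> mn ab; rewrite -(modn_dvdm a mn) ab modn_dvdm. Qed.

(** Arcs point from subscript [i] to [i + d] with [d <= k], so a bound on the source alone rules out
    wrapping. *)
Lemma gpetersen_arc_proj {n k m r : nat} (hm : 0 < m) {x y : 'I_n + 'I_n} :
  0 < k -> r = k %[mod m] -> (m %| n) || (gpetersen_index x + k < n) ->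
  gpetersen_arc k x y ->
  gpetersen_arc r (gpetersen_proj hm x) (gpetersen_proj hm y).
Proof.
move=> k_gt0 rk nowrap.
(* Treats outer arcs ([d = 1]) and inner arcs ([d = k]) together. *)
have red d (i j : 'I_n) : d <= k -> (m %| n) || (i + k < n) ->
    j == i + d %[mod n] -> j = i + d %[mod m].
  move=> dk /orP[mn /eqP|ikn]; first exact: modn_eq_dvd.
  have idn : i + d < n by apply: leq_ltn_trans ikn; rewrite leq_add2l.
  by rewrite (modn_small (ltn_ord j)) (modn_small idn) => /eqP->.
case: x nowrap => i /= nowrap; case: y => j //=.
- by move/(red _ _ _ k_gt0 nowrap) => ji; rewrite modnDml modn_mod ji.
- by move/eqP->.
- move/(red _ _ _ (leqnn k) nowrap) => ji.
  by rewrite modnDml modn_mod ji eqn_modDl rk.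
Qed.

(** A vertex is determined by its block, the quotient of its subscript by [m], and its projection;
    only [q] blocks occur. *)
Lemma card_gpetersen_proj_preim {n m : nat} (q : nat) (hm : 0 < m)
    (S : {set 'I_m + 'I_m}) :
  #|[set x : 'I_n + 'I_n |
      (gpetersen_index x < q * m) && (gpetersen_proj hm x \in S)]| <= q * #|S|.
Proof.
(* [inord] needs a target ['I_q.+1]; with no blocks the set is empty. *)
case: q => [|q]; first by rewrite leqn0 cards_eq0; apply/eqP/setP=> x; rewrite !inE.
pose f (x : 'I_n + 'I_n) : 'I_q.+1 * ('I_m + 'I_m) :=
  (inord (gpetersen_index x %/ m), gpetersen_proj hm x).
rewrite -[X in _ <= X * _]card_ord -cardsT -cardsX -(@card_in_imset _ _ f).
  apply/subset_leq_card/subsetP=> _ /imsetP[x + ->].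
  by rewrite !inE => /andP[].
move=> x y; rewrite !inE -2!(ltn_divLR _ _ hm) => /andP[xq _] /andP[yq _] [].
move/(congr1 val); rewrite /= !inordK // => eq_div.
by case: x y {xq yq} eq_div => i [] j //= eq_div [eq_mod]; congr (_ _);
  apply: val_inj; rewrite /= (divn_eq i m) (divn_eq j m) eq_div eq_mod.
Qed.

Lemma card_gpetersen_tail (n k : nat) :
  k <= n -> #|[set x : 'I_n + 'I_n | n - k <= gpetersen_index x]| <= 2 * k.
Proof.
(* [g j] is [n - 1 - j], so [g] enumerates the last [k] subscripts; the tail lies in its two copies,
   outer and inner. *)
move=> kn; pose g (j : 'I_k) := rev_ord (widen_ord kn j).
have gP (i : 'I_n) : n - k <= i -> exists j, i = g j.
  move=> nki; have ik : n - i.+1 < k by rewrite ltn_subLR // addSn ltnS addnC -leq_subLR.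
  by exists (Ordinal ik); rewrite -[LHS]rev_ordK; congr rev_ord; apply: val_inj.
apply: (@leq_trans #|inl @: (g @: 'I_k) :|: inr @: (g @: 'I_k)|); last first.
  rewrite cardsU mul2n -addnn (leq_trans (leq_subr _ _)) //.
  by rewrite leq_add // (leq_trans (leq_imset_card _ _)) //
    (leq_trans (leq_imset_card _ _)) // card_ord.
apply/subset_leq_card/subsetP; case=> i; rewrite !inE => /gP[j ->].
  by rewrite !imset_f.
by rewrite orbC !imset_f.
Qed.

Theorem theorem11 (n k m r : nat)
  (hk : 1 <= k) (hn : 2 * k < n)
  (hm : 0 < m) (hmk : m < k)
  (hr : r < m) (hrk : r = k %[mod m])
  (hr0 : 0 < 2 * r) (hrm : 2 * r < m) :
  (m %| n ->
     vertex_cover_number (@gpetersen n k)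
       <= n %/ m * vertex_cover_number (@gpetersen m r)) /\
  (~~ (m %| n) ->
     vertex_cover_number (@gpetersen n k)
       <= n %/ m * vertex_cover_number (@gpetersen m r) + 2 * k).
Proof.
have [S covS <-] := vertex_cover_number_attained (@gpetersen m r).
have arcS x y : gpetersen_arc r x y -> (x \in S) || (y \in S).
  move=> xy; move/forallP/(_ x)/forallP/(_ y): covS.
  by rewrite /gpetersen xy.
set q := n %/ m.
(* The cutoff [q * m] drops an incomplete last block, which keeps the count at [q * #|S|]; if
   [m %| n] it drops nothing. *)
pose A := [set x : 'I_n + 'I_n |
  (gpetersen_index x < q * m) && (gpetersen_proj hm x \in S)].
have cardA : #|A| <= q * #|S| by apply: card_gpetersen_proj_preim.
split=> [mn | _].
  apply: leq_trans cardA; apply/vertex_cover_number_min/vertex_cover_gpetersen.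
  move=> x y xy; have idx (z : 'I_n + 'I_n) : gpetersen_index z < q * m.
    by rewrite divnK //; case: z => i /=.
  by rewrite !inE !idx; apply/arcS/(gpetersen_arc_proj hm hk hrk _ xy); rewrite mn.
have kn : k <= n by apply: leq_trans (ltnW hn); rewrite leq_pmull.
pose B := [set x : 'I_n + 'I_n | n - k <= gpetersen_index x].
have cardAB : #|A :|: B| <= q * #|S| + 2 * k.
  rewrite cardsU (leq_trans (leq_subr _ _)) // leq_add //.
  exact: card_gpetersen_tail.
apply: leq_trans cardAB; apply/vertex_cover_number_min/vertex_cover_gpetersen.
have memAB x : gpetersen_proj hm x \in S -> x \in A :|: B.
  move=> xS; rewrite !inE xS andbT.
  case: (leqP (n - k)) => [|x_lt]; rewrite ?orbT ?orbF //.
  (* [n - k <= q * m], because [n = q * m + n %% m] and [n %% m < m < k]. *)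
  apply: (leq_trans x_lt); rewrite leq_subLR {1}(divn_eq n m) addnC leq_add2r.
  exact/ltnW/(ltn_trans _ hmk)/ltn_pmod.
(* An arc starting in the tail is covered by its source, which is in [B]; any other arc projects to
   an arc covered by [S]. *)
move=> x y xy; case: (leqP (n - k) (gpetersen_index x)) => [xB | x_lt].
  by rewrite !inE xB orbT.
have nowrap : gpetersen_index x + k < n by rewrite addnC -ltn_subRL.
have /arcS/orP[] : gpetersen_arc r (gpetersen_proj hm x) (gpetersen_proj hm y).
- by apply: (gpetersen_arc_proj hm hk hrk _ xy); rewrite nowrap orbT.
- by move/memAB->.
- by move/memAB->; rewrite orbT.
Qed.
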